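(* Let tasks $\{k,\ldots,n\}$ form a busy period on the optimal sample path of problem P1 (defined in the context). (i) Let $k<i\le n$. If for all $j$ with $k<j<i$ $$\sigma_{k,j}(a_k,d_j)\ge\sigma_{k,L_j}(a_k,a_{L_j+1})\quad\text{and}\quad\sigma_{k,j}(a_k,a_{j+1})\le\sigma_{k,R_j}(a_k,d_{R_j}),$$ and $$\sigma_{k,i}(a_k,a_{i+1})>\sigma_{k,R_i}(a_k,d_{R_i}),$$ then $R_i$ is the first critical task in $\{k,\ldots,n\}$, and it is right-critical. (ii) Let $k<i\le n$. If for all $j$ with $k<j<i$ $$\sigma_{k,j}(a_k,d_j)\ge\sigma_{k,L_j}(a_k,a_{L_j+1})\quad\text{and}\quad\sigma_{k,j}(a_k,a_{j+1})\le\sigma_{k,R_j}(a_k,d_{R_j}),$$ and $$\sigma_{k,i}(a_k,d_i)<\sigma_{k,L_i}(a_k,a_{L_i+1}),$$ then $L_i$ is the first critical task in $\{k,\ldots,n\}$, and it is left-critical.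
   Context: Problem P1. There are $N$ tasks, served first-come-first-served and nonpreemptively by a single server. Task $i$ has arrival time $a_i$, deadline $d_i$, number of bits $v_i>0$, with $0\le a_1\le a_2\le\dots\le a_N$, and an energy-per-bit function $\omega_i:(0,\infty)\to\mathbb{R}$ of the transmission time per bit $\tau$. Each $\omega_i$ is nonnegative, strictly convex, monotonically decreasing, differentiable, and satisfies $\lim_{\tau\to0}\dot\omega_i(\tau)=-\infty$ (a dot denotes the derivative). P1 is: minimize $\sum_{i=1}^N v_i\omega_i(\tau_i)$ over $\tau_1,\dots,\tau_N>0$ subject to $x_i=\max(x_{i-1},a_i)+v_i\tau_i\le d_i$ for $i=1,\dots,N$, where $x_0=0$. P1 is assumed feasible; its unique optimal solution is $(\tau_i^* )$, with departure times $(x_i^* )$ (the optimal sample path). Busy period (BP). A contiguous set of tasks $\{k,\dots,n\}$ is a busy period on the optimal sample path if $x_{k-1}^*<a_k$, $x_n^*<a_{n+1}$, and $x_i^*\ge a_{i+1}$ for every $i=k,\dots,n-1$. The first condition is vacuous for $k=1$. On the optimal sample path, $\{k,\dots,n\}$ is a busy period if and only if $d_{k-1}<a_k$, $d_n<a_{n+1}$ and $d_i\ge a_{i+1}$ for $i=k,\dots,n-1$; for $n=N$, $a_{N+1}$ denotes a fixed number with $a_{N+1}>d_N$. Critical tasks. Suppose tasks $i$ and $i+1$ are both within a BP on the optimal sample path. Task $i$ is critical if $\dot\omega_i(\tau_i^* )\ne\dot\omega_{i+1}(\tau_{i+1}^* )$; it is left-critical if $\dot\omega_i(\tau_i^* )>\dot\omega_{i+1}(\tau_{i+1}^*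 )$, and right-critical if $\dot\omega_i(\tau_i^* )<\dot\omega_{i+1}(\tau_{i+1}^* )$. The first critical task is the one of smallest index. Common derivative $\sigma$. For $i\le j$ and $0\le t_1<t_2$, the system $\sum_{m=i}^{j}\tau_m v_m=t_2-t_1$, $\dot\omega_m(\tau_m)=\dot\omega_{m+1}(\tau_{m+1})$ for $m=i,\dots,j-1$, in unknowns $\tau_i,\dots,\tau_j\in(0,\infty)$, has a unique solution; $\sigma_{i,j}(t_1,t_2)$ denotes the common value of $\dot\omega_m(\tau_m)$, $i\le m\le j$, at this solution. When $t_1=t_2$, set $\sigma_{i,j}(t_1,t_2)=-\infty$. Indices $R_i$, $L_i$. For the BP $\{k,\dots,n\}$ and $k<i\le n$: $R_i$ is the largest index $s\in\{k,\dots,i-1\}$ such that $\sigma_{k,s}(a_k,d_s)\le\sigma_{k,j}(a_k,d_j)$ for all $j\in\{k,\dots,i-1\}$; $L_i$ is the largest index $s\in\{k,\dots,i-1\}$ such that $\sigma_{k,s}(a_k,a_{s+1})\ge\sigma_{k,j}(a_k,a_{j+1})$ for all $j\in\{k,\dots,i-1\}$.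
   Formalization: In part (i), for i = n only, the formal statement also assumes σ_{k,n}(a_k,d_n) > σ_{k,R_n}(a_k,d_{R_n}); without it the claim is false, e.g. N=2, a=(0,0), d=(3/2,2), v=(1,1), ω_i(τ)=1/τ, a_3=100. *)

(* Defs.v *)
(* MathComp-Analysis, over an arbitrary real type R. *)
From HB Require Import structures.
From mathcomp Require Import all_boot all_order all_algebra.
From mathcomp Require Import all_classical all_reals all_analysis.

Set Implicit Arguments.
Unset Strict Implicit.
Unset Printing Implicit Defensive.

Import Order.TTheory GRing.Theory Num.Theory.
Import numFieldNormedType.Exports.

Local Open Scope classical_set_scope.
Local Open Scope ring_scope.

(* Tasks are numbered 1, ..., ntasks; values of the fields at other indices are
   irrelevant, except arrival ntasks.+1, the sentinel a_{N+1}. *)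
Record schedule (R : Type) := Schedule {
  ntasks : nat ;
  arrival : nat -> R ;
  deadline : nat -> R ;
  nbits : nat -> R ;
  energy : nat -> R -> R
}.

(* Functions on (0, +oo) are represented by total functions, of which only the
   values at positive arguments matter. *)
Definition strictly_convex_pos (R : realType) (f : R -> R) : Prop :=
  forall x y t : R, 0 < x -> 0 < y -> x != y -> 0 < t < 1 ->
    f (t * x + (1 - t) * y) < t * f x + (1 - t) * f y.

Record energy_function (R : realType) (f : R -> R) : Prop := EnergyFunction {
  energy_ge0 : forall x : R, 0 < x -> 0 <= f x ;
  energy_convex : strictly_convex_pos f ;
  energy_decreasing : forall x y : R, 0 < x -> x <= y -> f y <= f x ;
  energy_derivable : forall x : R, 0 < x -> derivable f x 1 ;
  energy_derive_cvg0 : derive1 f x @[x --> 0^'+] --> -oo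
}.

Record wf_schedule (R : realType) (p : schedule R) : Prop := WfSchedule {
  wf_arrival_ge0 : 0 <= arrival p 1 ;
  wf_arrival_sorted :
    forall i, (1 <= i < ntasks p)%N -> arrival p i <= arrival p i.+1 ;
  wf_sentinel : deadline p (ntasks p) < arrival p (ntasks p).+1 ;
  wf_nbits_gt0 : forall i, (1 <= i <= ntasks p)%N -> 0 < nbits p i ;
  wf_energy : forall i, (1 <= i <= ntasks p)%N -> energy_function (energy p i)
}.

Section Optimization.
Context {R : realType}.
Implicit Types (p : schedule R) (tau : nat -> R) (i j k n : nat).

Fixpoint departure p tau i : R :=
  if i is i'.+1 then
    Num.max (departure p tau i') (arrival p i) + nbits p i * tau i
  else 0.

Definition feasible p tau : Prop :=
  forall i, (1 <= i <= ntasks p)%N ->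
    0 < tau i /\ departure p tau i <= deadline p i.

Definition cost p tau : R :=
  \sum_(1 <= i < (ntasks p).+1) nbits p i * energy p i (tau i).

Definition optimal p tau : Prop :=
  feasible p tau /\ forall tau', feasible p tau' -> cost p tau <= cost p tau'.

Definition busy_period p tau k n : Prop :=
  [/\ (1 <= k <= n)%N /\ (n <= ntasks p)%N,
      (1 < k)%N -> departure p tau k.-1 < arrival p k,
      departure p tau n < arrival p n.+1 &
      forall i, (k <= i < n)%N -> arrival p i.+1 <= departure p tau i].

Definition energy_slope p i (t : R) : R := derive1 (energy p i) t.

Definition same_busy_period p tau i j : Prop :=
  exists k n, [/\ busy_period p tau k n, (k <= i <= n)%N & (k <= j <= n)%N].

Definition critical p tau i : Prop :=
  same_busy_period p tau i i.+1 /\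
  energy_slope p i (tau i) <> energy_slope p i.+1 (tau i.+1).

Definition left_critical p tau i : Prop :=
  same_busy_period p tau i i.+1 /\
  energy_slope p i (tau i) > energy_slope p i.+1 (tau i.+1).

Definition right_critical p tau i : Prop :=
  same_busy_period p tau i i.+1 /\
  energy_slope p i (tau i) < energy_slope p i.+1 (tau i.+1).

Definition first_critical p tau k n c : Prop :=
  [/\ (k <= c <= n)%N, critical p tau c &
      forall i, (k <= i <= n)%N -> critical p tau i -> (c <= i)%N].

Definition slope_system p i j (t1 t2 : R) tau : Prop :=
  [/\ forall m, (i <= m <= j)%N -> 0 < tau m,
      \sum_(i <= m < j.+1) tau m * nbits p m = t2 - t1 &
      forall m, (i <= m < j)%N ->
        energy_slope p m (tau m) = energy_slope p m.+1 (tau m.+1)].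

(* For t1 < t2 the set below is a singleton when 1 <= i <= j <= ntasks p and p
   is well formed; the value at t2 < t1 is a dummy, like the default of get. *)
Definition sigma p i j (t1 t2 : R) : \bar R :=
  if t1 < t2 then
    (get [set s : R | exists2 tau, slope_system p i j t1 t2 tau &
       forall m, (i <= m <= j)%N -> energy_slope p m (tau m) = s])%:E
  else -oo%E.

(* R_i and L_i in the busy period starting with task k; the maxima range over a
   nonempty set as soon as k < i. *)
Definition R_index p k i : nat :=
  (\max_(k <= s < i | [forall j : 'I_i, (k <= j)%N ==>
     (sigma p k s (arrival p k) (deadline p s) <=
      sigma p k j (arrival p k) (deadline p j))%E]) s)%N.

Definition L_index p k i : nat :=
  (\max_(k <= s < i | [forall j : 'I_i, (k <= j)%N ==>
     (sigma p k j (arrival p k) (arrival p j.+1) <=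
      sigma p k s (arrival p k) (arrival p s.+1))%E]) s)%N.

Definition no_conflict_before p k i : Prop :=
  forall j, (k < j < i)%N ->
    (sigma p k (L_index p k j) (arrival p k) (arrival p (L_index p k j).+1)
       <= sigma p k j (arrival p k) (deadline p j))%E /\
    (sigma p k j (arrival p k) (arrival p j.+1)
       <= sigma p k (R_index p k j) (arrival p k) (deadline p (R_index p k j)))%E.

End Optimization.

(* Main.v *)
(* Let s be sigma at R_i (part (i)) or at L_i (part (ii)), and compare the optimal
   path x with the path y leaving a_k on which every task has slope s.  An
   exchange argument between neighbouring tasks shows that the slope on x can
   increase after task j only if x_j = d_j and decrease only if x_j = a_{j+1}.
   As there is no conflict before i, y stays between arrivals and deadlines up to
   i - 1.  In part (i), if the slope on x leaves s upwards before R_i, then x stays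
   above y and misses the deadline of R_i, which y meets exactly; if it leaves s
   downwards, or does not leave s at R_i, then x stays at or below y up to i,
   although y is too early there.  Part (ii) is the mirror image. *)

Require Import Defs.
From mathcomp Require Import all_boot all_order all_algebra.
From mathcomp Require Import all_classical all_reals all_analysis.
From mathcomp Require Import ring lra.

Set Implicit Arguments.
Unset Strict Implicit.
Unset Printing Implicit Defensive.

Import Order.TTheory GRing.Theory Num.Theory.
Import numFieldNormedType.Exports.
Local Open Scope classical_set_scope.
Local Open Scope ring_scope.

(** * Tangents and slopes of an energy function *)

Section EnergyFunctions.
Context {R : realType}.
Implicit Types (f g : R -> R) (x y s : R).

Lemma derive1_expansion f x eps : derivable f x 1 -> 0 < eps ->
  exists2 del : R, 0 < del & forall h, 0 < `|h| < del ->
    `|f (x + h) - f x - h * derive1 f x| < eps * `|h|.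
Proof.
move=> df eps0.
have /cvgrPdist_lt/(_ _ eps0) : h^-1 *: (f (h + x) - f x) @[h --> 0^'] --> derive1 f x.
  by have := df; rewrite /derivable /shift /= => /cvg_ex[l];
    under eq_fun do rewrite /GRing.scale /= mulr1; move=> dl;
    rewrite /derive1 (cvg_lim _ dl).
case=> d /= d0 Hd; exists d => // h /andP[h0 hd].
have hN0 : h != 0 by rewrite -normr_gt0.
have := Hd h; rewrite /ball /= sub0r normrN => /(_ hd hN0).
rewrite -(ltr_pM2r h0) -normrM distrC (addrC h x).
by rewrite /GRing.scale /= mulrBl mulrAC mulVf // mul1r (mulrC h).
Qed.

Lemma lt_derive1_near f x c : derivable f x 1 -> derive1 f x < c ->
  exists2 del : R, 0 < del & forall h, 0 < h < del -> f (x + h) < f x + c * h.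
Proof.
move=> df fc; have [] := @derive1_expansion f x (c - derive1 f x) df.
  by rewrite subr_gt0.
move=> d d0 Hd; exists d => // h /andP[h0 hd].
by have := Hd h; rewrite gtr0_norm// h0 => /(_ hd); rewrite ltr_norml => /andP[_]; nra.
Qed.

Lemma gt_derive1_near f x c : derivable f x 1 -> c < derive1 f x ->
  exists2 del : R, 0 < del & forall h, 0 < h < del -> f (x - h) < f x - c * h.
Proof.
move=> df fc; have [] := @derive1_expansion f x (derive1 f x - c) df.
  by rewrite subr_gt0.
move=> d d0 Hd; exists d => // h /andP[h0 hd].
have := Hd (- h); rewrite normrN gtr0_norm// h0 => /(_ hd).
by rewrite ltr_norml => /andP[_]; nra.
Qed.

Lemma strictly_convex_chord f x y h : strictly_convex_pos f ->
  0 < x -> 0 < y -> x != y -> 0 < h < 1 ->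
  f (x + h * (y - x)) < f x + h * (f y - f x).
Proof.
move=> cf x0 y0 xy /andP[h0 h1].
have := cf x y (1 - h) x0 y0 xy.
have -> : (1 - h) * x + (1 - (1 - h)) * y = x + h * (y - x) by ring.
have -> : (1 - h) * f x + (1 - (1 - h)) * f y = f x + h * (f y - f x) by ring.
by apply; lra.
Qed.

(** If [y] lay below the tangent at [x], convexity would keep the points [x + h * (y - x)] below it
    by at least [h] times that defect, while differentiability makes the deviation from the tangent
    smaller than this for small [h]. *)
Lemma energy_tangent_le f x y : energy_function f -> 0 < x -> 0 < y ->
  derive1 f x * (y - x) <= f y - f x.
Proof.
move=> ef x0 y0; rewrite leNgt; apply/negP => fxy.
have xy : x != y by apply: contraTN fxy => /eqP ->; rewrite !subrr mulr0 ltxx.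
have D0 : 0 < `|y - x| by rewrite normr_gt0 subr_eq0 eq_sym.
have [d d0 Hd] := @derive1_expansion f x
  ((derive1 f x * (y - x) - (f y - f x)) / `|y - x|)
  (energy_derivable ef x0) ltac:(by rewrite divr_gt0// subr_gt0).
(* Half of the minimum is strictly below both the convexity bound 1 and the radius of the expansion,
   rescaled by the distance from [x] to [y]. *)
pose h := Num.min (d / `|y - x|) 1 / 2.
have m0 : 0 < Num.min (d / `|y - x|) 1 by rewrite lt_min ltr01 divr_gt0.
have h0 : 0 < h by rewrite divr_gt0.
have [h1 hd] : h < 1 /\ h < d / `|y - x|.
  by rewrite /h; split; case: (leP (d / `|y - x|) 1) m0 => *; lra.
have := Hd (h * (y - x)).
rewrite normrM (gtr0_norm h0) mulr_gt0//= -ltr_pdivlMr// => /(_ hd).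
rewrite mulrCA divfK ?gt_eqF// => /ltr_normlP[+ _].
have := @strictly_convex_chord f x y h (energy_convex ef) x0 y0 xy.
by rewrite h0 h1 => /(_ isT); lra.
Qed.

(** The weak inequality at the midpoint, combined with strict convexity there, gives strictness at
    [y]. *)
Lemma energy_tangent_lt f x y : energy_function f -> 0 < x -> 0 < y -> x != y ->
  derive1 f x * (y - x) < f y - f x.
Proof.
move=> ef x0 y0 xy.
have := @strictly_convex_chord f x y 2^-1 (energy_convex ef) x0 y0 xy ltac:(lra).
have := @energy_tangent_le f x (x + 2^-1 * (y - x)) ef x0 ltac:(lra).
by rewrite addrAC subrr add0r; lra.
Qed.

(** Adding the strict tangent inequalities at two points, each evaluated at the other, orders the
    slopes as the points. *)
Lemma energy_derive1_ltr f x y : energy_function f -> 0 < x -> 0 < y ->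
  (derive1 f x < derive1 f y) = (x < y).
Proof.
move=> ef.
have lt_der a b : 0 < a -> a < b -> derive1 f a < derive1 f b.
  move=> a0 ab; have b0 := lt_trans a0 ab.
  have := energy_tangent_lt ef a0 b0 ltac:(by rewrite lt_eqF).
  have := energy_tangent_lt ef b0 a0 ltac:(by rewrite gt_eqF).
  by move: ab; rewrite -subr_gt0 => ab; nra.
move=> x0 y0; case: (ltgtP x y) => [|yx|->]; [exact: lt_der| |exact: ltxx].
by apply/negbTE; rewrite -leNgt ltW// lt_der.
Qed.

Lemma energy_derive1_lt0 f x : energy_function f -> 0 < x -> derive1 f x < 0.
Proof.
move=> ef x0.
have := energy_tangent_lt ef x0 (addr_gt0 x0 ltr01) ltac:(by rewrite lt_eqF// ltrDl).
have := energy_decreasing ef x0 (ltac:(lra) : x <= x + 1).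
by rewrite addrAC subrr add0r; lra.
Qed.

(** A Darboux argument, as the derivative is not assumed continuous: [s] is attained where
    [f - s * id] has an interior minimum. The limit at 0 gives a point [a] of slope below [s]; since
    [f] is nonnegative and [s] negative, [f - s * id] is at least [- s * x], which dictates the
    choice of [b]. *)
Lemma energy_derive1_surj f s : energy_function f -> s < 0 ->
  exists2 x, 0 < x & derive1 f x = s.
Proof.
move=> ef s0.
have [a a0 fa] : exists2 a, 0 < a & derive1 f a < s.
  have /cvgrNyPlt/(_ s) := energy_derive_cvg0 ef.
  case=> d /= d0 Hd; exists (d / 2); first by rewrite divr_gt0.
  apply: Hd; rewrite /= ?divr_gt0// sub0r normrN gtr0_norm ?divr_gt0//; lra.
(* f - s * id decreases near 0 and exceeds its value at a from b on, so its minimum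
   on [a/2, b] is interior. *)
pose h x := f x - s * x; pose b := a + 1 + h a / - s.
have ha0 : 0 < h a by rewrite /h; have := energy_ge0 ef a0; nra.
have ab : a + 1 < b by rewrite /b ltrDl divr_gt0// oppr_gt0.
have hb : h a < h b.
  rewrite /h; have := energy_ge0 ef (ltac:(lra) : 0 < b).
  have : - s * (h a / - s) = h a by field; rewrite lt_eqF.
  by rewrite -/(h a) /b; nra.
have a'0 : 0 < a / 2 by lra.
(* The tangent to [f] at [a] has slope below [s], so going left from [a] raises [h]. *)
have ha' : h a < h (a / 2).
  by rewrite /h; have := energy_tangent_le ef a0 a'0; nra.
have dh x : 0 < x -> is_derive x 1 h (derive1 f x - s).
  move=> x0; have df := energy_derivable ef x0.
  have df1 : is_derive x 1 f (derive1 f x) by apply: DeriveDef => //; rewrite derive1E.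
  rewrite (_ : h = f - s *: id)//.
  by apply: is_derive_eq; rewrite /GRing.scale /= mulr1.
have a'b : a / 2 <= b by lra.
have [c] := @EVT_min _ h _ _ a'b ltac:(apply: derivable_within_continuous => x;
  rewrite in_itv /= => /andP[xa _]; have := dh x ltac:(lra); by case).
rewrite in_itv /= => /andP[ac cb] hc.
have ca : a / 2 < c.
  rewrite lt_neqAle ac andbT; apply/eqP => ca.
  by have := hc a; rewrite in_itv /= -ca (leNgt (h _)) ha' => /(_ ltac:(apply/andP; lra)).
have cb' : c < b.
  rewrite lt_neqAle cb andbT; apply/eqP => cb1.
  by have := hc a; rewrite in_itv /= cb1 (leNgt (h _)) hb => /(_ ltac:(apply/andP; lra)).
have c0 : 0 < c by lra.
exists c => //.
have : is_derive c 1 h 0.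
  apply: (derive1_at_min a'b); last 1 first.
  - by move=> t; rewrite in_itv/= => /andP[/ltW t1 /ltW t2]; apply: hc; rewrite in_itv /= t1.
  - by move=> t; rewrite in_itv /= => /andP[t1 _]; have [] := dh t ltac:(lra).
  - by rewrite in_itv /= ca.
move=> [_ h'0]; have [_] := dh c c0; rewrite h'0 => /esym/eqP.
by rewrite subr_eq0 => /eqP.
Qed.

End EnergyFunctions.

(** Serves to bracket the slopes of finitely many tasks; a negative upper end keeps the bracket
    inside the range of slopes. *)
Lemma neg_seq_bounds {R : realDomainType} (l : seq R) : {in l, forall x, x < 0} ->
  exists ab : R * R, [/\ ab.1 <= ab.2, ab.2 < 0 & {in l, forall x, ab.1 <= x <= ab.2}].
Proof.
elim: l => [_|x l IH xl]; first by exists (-1, -1); split => //=; lra.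
have [y yl|[a b] [/= ab b0 lab]] := IH; first by apply: xl; rewrite inE yl orbT.
have x0 : x < 0 by apply: xl; rewrite inE eqxx.
exists (Num.min a x, Num.max b x); split => /=.
- by rewrite ge_min le_max ab.
- by rewrite gt_max b0.
- move=> y; rewrite inE => /predU1P[->|/lab /andP[ay yb]].
    by rewrite ge_min le_max lexx !orbT.
  by rewrite ge_min le_max ay yb.
Qed.

Lemma sumr_nat_gt0 {R : numDomainType} (m n : nat) (F : nat -> R) : (m < n)%N ->
  (forall i, (m <= i < n)%N -> 0 < F i) -> 0 < \sum_(m <= i < n) F i.
Proof.
move=> mn F0; apply: (le_lt_trans _ (ltr_sum_nat mn F0)).
by rewrite big1_eq.
Qed.

(** * Inverse slopes, and [sigma] as the inverse of a total duration *)

Section Sigma.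
Context {R : realType}.
Implicit Types (p : schedule R) (i j m : nat) (s t : R).

(** For a task of a well-formed schedule this is the inverse of the slope function on negative [s];
    no slope is nonnegative, so for other [s] the value is a dummy. *)
Definition slope_inv p m s : R := get [set t : R | 0 < t /\ energy_slope p m t = s].

(** Strictly increasing in [s < 0] with all positive values attained; [sigma p i j t1 t2] is the [s]
    at which it equals [t2 - t1]. *)
Definition common_duration p i j s : R :=
  \sum_(i <= m < j.+1) slope_inv p m s * nbits p m.

Lemma energy_slope_lt0 p m t : wf_schedule p -> (1 <= m <= ntasks p)%N ->
  0 < t -> energy_slope p m t < 0.
Proof. by move=> hp hm; apply: energy_derive1_lt0; exact: wf_energy. Qed.

Lemma energy_slope_ltr p m s t : wf_schedule p -> (1 <= m <= ntasks p)%N ->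
  0 < s -> 0 < t -> (energy_slope p m s < energy_slope p m t) = (s < t).
Proof. by move=> hp hm; apply: energy_derive1_ltr; exact: wf_energy. Qed.

Lemma slope_inv_spec p m s : wf_schedule p -> (1 <= m <= ntasks p)%N -> s < 0 ->
  0 < slope_inv p m s /\ energy_slope p m (slope_inv p m s) = s.
Proof.
move=> hp hm s0; rewrite /slope_inv.
have [t t0 ts] := energy_derive1_surj (wf_energy hp hm) s0.
exact: (@getPex _ [set t : R | 0 < t /\ energy_slope p m t = s] (ex_intro _ t (conj t0 ts))).
Qed.

Lemma slope_inv_gt0 p m s : wf_schedule p -> (1 <= m <= ntasks p)%N -> s < 0 ->
  0 < slope_inv p m s.
Proof. by move=> hp hm /(slope_inv_spec hp hm)[]. Qed.

Lemma slope_inv_ltr p m s t : wf_schedule p -> (1 <= m <= ntasks p)%N ->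
  s < 0 -> 0 < t -> (slope_inv p m s < t) = (s < energy_slope p m t).
Proof.
move=> hp hm s0 t0; have [i0 is_] := slope_inv_spec hp hm s0.
by rewrite -[in RHS]is_ energy_slope_ltr.
Qed.

Lemma slope_inv_gtr p m s t : wf_schedule p -> (1 <= m <= ntasks p)%N ->
  s < 0 -> 0 < t -> (t < slope_inv p m s) = (energy_slope p m t < s).
Proof.
move=> hp hm s0 t0; have [i0 is_] := slope_inv_spec hp hm s0.
by rewrite -[in RHS]is_ energy_slope_ltr.
Qed.

Lemma slope_inv_mono p m s t : wf_schedule p -> (1 <= m <= ntasks p)%N ->
  s < 0 -> t < 0 -> (slope_inv p m s <= slope_inv p m t) = (s <= t).
Proof.
move=> hp hm s0 t0; have [i0 is_] := slope_inv_spec hp hm s0.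
by rewrite leNgt slope_inv_ltr// is_ -leNgt.
Qed.

Lemma energy_slopeK p m t : wf_schedule p -> (1 <= m <= ntasks p)%N -> 0 < t ->
  slope_inv p m (energy_slope p m t) = t.
Proof.
move=> hp hm t0; have s0 := energy_slope_lt0 hp hm t0.
by apply/eqP; rewrite eq_le !leNgt slope_inv_ltr// slope_inv_gtr// ltxx.
Qed.

(** An increasing map from a segment onto the segment between its end values is continuous; a
    preimage of [t] is the slope at [t]. *)
Lemma slope_inv_continuous p m a b : wf_schedule p -> (1 <= m <= ntasks p)%N ->
  a <= b -> b < 0 -> {within `[a, b], continuous (slope_inv p m)}.
Proof.
move=> hp hm ab b0; apply: segment_inc_surj_continuous.
  move=> s t; rewrite !in_itv /= => /andP[_ sb] /andP[_ tb].
  by apply: slope_inv_mono => //; apply: le_lt_trans b0.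
move=> t; rewrite /= in_itv /= => /andP[at_ tb].
have a0 := le_lt_trans ab b0.
have t0 : 0 < t := lt_le_trans (slope_inv_gt0 hp hm a0) at_.
exists (energy_slope p m t); last exact: energy_slopeK.
rewrite /= in_itv /=; apply/andP; split.
  by rewrite leNgt -slope_inv_gtr// -leNgt.
by rewrite leNgt -slope_inv_ltr// -leNgt.
Qed.

Lemma common_duration_continuous p i j a b : wf_schedule p ->
  (1 <= i)%N -> (j <= ntasks p)%N ->
  a <= b -> b < 0 -> {within `[a, b], continuous (common_duration p i j)}.
Proof.
move=> hp i1 jN ab b0.
have -> : common_duration p i j =
    \sum_(i <= m < j.+1) (fun s => slope_inv p m s * nbits p m).
  by apply/funext => s; rewrite /common_duration fct_sumE.
rewrite big_nat_cond.
apply: (@big_ind _ (fun f => {within `[a, b], continuous f})).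
- by apply: continuous_subspaceT => x; exact: cvg_cst.
- by move=> f g; exact: within_continuousD.
- move=> m /andP[/andP[im mj] _] x; apply: cvgM; last exact: cvg_cst.
  by apply: slope_inv_continuous => //; rewrite (leq_trans i1)//= (leq_trans _ jN).
Qed.

Lemma ler_common_duration p i j s t : wf_schedule p ->
  (1 <= i <= j)%N -> (j <= ntasks p)%N -> s < 0 -> t < 0 ->
  (common_duration p i j s <= common_duration p i j t) = (s <= t).
Proof.
move=> hp /andP[i1 ij] jN s0 t0.
have mono a b : a < 0 -> b < 0 -> a < b -> common_duration p i j a < common_duration p i j b.
  move=> a0 b0 ab; rewrite /common_duration.
  apply: ltr_sum_nat => // m /andP[im mj].
  have hm : (1 <= m <= ntasks p)%N by rewrite (leq_trans i1)//= (leq_trans _ jN).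
  rewrite ltr_pM2r ?wf_nbits_gt0//.
  by rewrite ltNge slope_inv_mono// -ltNge.
case: (ltgtP s t) => [st|ts|->]; [by rewrite ltW// mono| |exact: lexx].
by apply/negbTE; rewrite -ltNge mono.
Qed.

(** Intermediate values. If every task spent the same time [c] per bit, the total would be [T]. A
    slope below all slopes at [c] makes each task at most that long, and a slope above all of them
    at least that long. *)
Lemma common_duration_surj p i j T : wf_schedule p ->
  (1 <= i <= j)%N -> (j <= ntasks p)%N -> 0 < T ->
  exists2 s, s < 0 & common_duration p i j s = T.
Proof.
move=> hp /andP[i1 ij] jN T0.
have hm m : (i <= m < j.+1)%N -> (1 <= m <= ntasks p)%N.
  by move=> /andP[im mj]; rewrite (leq_trans i1)//= (leq_trans _ jN).
pose V := \sum_(i <= m < j.+1) nbits p m.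
have V0 : 0 < V.
  by apply: sumr_nat_gt0 => // m ijm; rewrite wf_nbits_gt0 ?hm.
pose c := T / V.
have c0 : 0 < c by rewrite divr_gt0.
have [|[a b] [/= ab b0 slab]] :=
    @neg_seq_bounds R [seq energy_slope p m c | m <- index_iota i j.+1].
  move=> x /mapP[m]; rewrite mem_index_iota => /hm {}hm ->.
  exact: energy_slope_lt0.
have {slab} slab m : (i <= m < j.+1)%N -> a <= energy_slope p m c <= b.
  by move=> ijm; apply: slab; apply: map_f; rewrite mem_index_iota.
have cT : \sum_(i <= m < j.+1) c * nbits p m = T.
  by rewrite -mulr_sumr divfK// gt_eqF.
have aT : common_duration p i j a <= T.
  rewrite -cT; apply: ler_sum_nat => m ijm.
  rewrite ler_pM2r ?wf_nbits_gt0 ?hm// leNgt slope_inv_gtr ?hm//; last lra.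
  by rewrite -leNgt; have /andP[] := slab m ijm.
have bT : T <= common_duration p i j b.
  rewrite -cT; apply: ler_sum_nat => m ijm.
  rewrite ler_pM2r ?wf_nbits_gt0 ?hm// leNgt slope_inv_ltr ?hm//.
  by rewrite -leNgt; have /andP[] := slab m ijm.
have [|s] := @IVT _ (common_duration p i j) a b T ab (common_duration_continuous hp i1 jN ab b0).
  by rewrite ge_min le_max aT bT orbT.
by rewrite in_itv /= => /andP[_ sb] sT; exists s => //; lra.
Qed.

(** The set under [get] is inhabited by the inverse slopes at the [s0] of [common_duration_surj].
    Whatever [get] returns, its witness satisfies [tau m = slope_inv p m s] for that common slope
    [s], which turns the duration equation of the system into one for [common_duration]. *)
Lemma sigma_EFin p i j t1 t2 : wf_schedule p ->
  (1 <= i <= j)%N -> (j <= ntasks p)%N -> t1 < t2 ->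
  exists s, [/\ s < 0, sigma p i j t1 t2 = s%:E & common_duration p i j s = t2 - t1].
Proof.
move=> hp ij jN t12.
have hm m : (i <= m <= j)%N -> (1 <= m <= ntasks p)%N.
  by case/andP: ij => i1 _ /andP[im mj]; rewrite (leq_trans i1)//= (leq_trans _ jN).
have [s0 s00 s0T] := common_duration_surj hp ij jN (ltac:(lra) : 0 < t2 - t1).
rewrite /sigma t12.
set S := (X in get X).
have [tau [tau0 tauT _] taus] : S (get S).
  apply: getPex; exists s0; exists (fun m => slope_inv p m s0).
    split; [move=> m ijm|exact: s0T|move=> m /andP[im mj]].
      exact: slope_inv_gt0 hp (hm m ijm) s00.
    rewrite (slope_inv_spec hp (hm m _) s00).2 ?im ?(ltnW mj)//.
    by rewrite (slope_inv_spec hp (hm m.+1 _) s00).2// mj leqW.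
  by move=> m ijm; rewrite (slope_inv_spec hp (hm m ijm) s00).2.
exists (get S); split => //.
  case/andP: ij => i1 ij; rewrite -(taus i) ?leqnn//.
  by apply: energy_slope_lt0; rewrite ?hm ?tau0 ?leqnn.
rewrite -tauT; apply: eq_big_nat => m ijm.
by rewrite -(taus m)// energy_slopeK ?hm// tau0.
Qed.

Lemma common_duration_gt0 p i j s : wf_schedule p ->
  (1 <= i <= j)%N -> (j <= ntasks p)%N -> s < 0 -> 0 < common_duration p i j s.
Proof.
move=> hp /andP[i1 ij] jN s0; apply: sumr_nat_gt0 => // m /andP[im mj].
have hm : (1 <= m <= ntasks p)%N by rewrite (leq_trans i1)//= (leq_trans _ jN).
by rewrite mulr_gt0 ?slope_inv_gt0 ?wf_nbits_gt0.
Qed.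

(** Together with [sigma_ge], trades comparisons of slopes for comparisons of times. When [t2 <= t1]
    the value -oo still agrees with the right-hand side, because durations are positive. *)
Lemma sigma_le p i j t1 t2 s : wf_schedule p ->
  (1 <= i <= j)%N -> (j <= ntasks p)%N -> s < 0 ->
  (sigma p i j t1 t2 <= s%:E)%E = (t2 - t1 <= common_duration p i j s).
Proof.
move=> hp ij jN s0; have [t21|t12] := leP t2 t1; last first.
  have [r [r0 -> <-]] := sigma_EFin hp ij jN t12.
  by rewrite lee_fin ler_common_duration.
rewrite /sigma ltNge t21 /= leNye; apply/esym.
by have := common_duration_gt0 hp ij jN s0; lra.
Qed.

Lemma sigma_ge p i j t1 t2 s : wf_schedule p ->
  (1 <= i <= j)%N -> (j <= ntasks p)%N -> s < 0 ->
  (s%:E <= sigma p i j t1 t2)%E = (common_duration p i j s <= t2 - t1).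
Proof.
move=> hp ij jN s0; have [t21|t12] := leP t2 t1; last first.
  have [r [r0 -> <-]] := sigma_EFin hp ij jN t12.
  by rewrite lee_fin ler_common_duration.
rewrite /sigma ltNge t21 /= leeNy_eq /=; apply/esym/negbTE.
by rewrite -ltNge; have := common_duration_gt0 hp ij jN s0; lra.
Qed.

End Sigma.

(** * Exchange arguments on the optimal path *)

Section Exchange.
Context {R : realType}.
Implicit Types (p : schedule R) (tau : nat -> R) (i j k l m n : nat).

(** With [c] strictly between the two slopes, a small step takes [f] and [g] below their lines of
    slope [c]. Dividing by [va] and [vb] makes both tasks trade the same amount [eps] of time, so
    the terms in [c] cancel. *)
Lemma exchange_gain (f g : R -> R) (x y va vb del : R) :
  derivable f x 1 -> derivable g y 1 -> derive1 f x < derive1 g y ->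
  0 < va -> 0 < vb -> 0 < del ->
  exists2 eps : R, 0 < eps < del &
    va * f (x + eps / va) + vb * g (y - eps / vb) < va * f x + vb * g y.
Proof.
move=> df dg fg va0 vb0 del0; pose c := (derive1 f x + derive1 g y) / 2.
have [d1 d10 Hf] := @lt_derive1_near _ f x c df ltac:(rewrite /c; lra).
have [d2 d20 Hg] := @gt_derive1_near _ g y c dg ltac:(rewrite /c; lra).
pose M := Num.min del (Num.min (d1 * va) (d2 * vb)).
have M0 : 0 < M by rewrite !lt_min del0 !mulr_gt0.
have [M1 M2 M3] : [/\ M <= del, M <= d1 * va & M <= d2 * vb].
  by rewrite /M !ge_min !lexx !orbT.
exists (M / 2); first by rewrite divr_gt0//=; lra.
have := Hf (M / 2 / va); rewrite !divr_gt0// ltr_pdivrMr// => /(_ ltac:(rewrite /=; lra)).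
have := Hg (M / 2 / vb); rewrite !divr_gt0// ltr_pdivrMr// => /(_ ltac:(rewrite /=; lra)).
rewrite -(ltr_pM2l vb0) => G; rewrite -(ltr_pM2l va0) => F.
have Ea : va * (c * (M / 2 / va)) = c * (M / 2) by field; rewrite gt_eqF.
have Eb : vb * (c * (M / 2 / vb)) = c * (M / 2) by field; rewrite gt_eqF.
by move: F G; rewrite !mulrDr mulrN Ea Eb; lra.
Qed.

Lemma eq_departure p tau tau' j :
  (forall m, (m <= j)%N -> tau' m = tau m) -> departure p tau' j = departure p tau j.
Proof.
elim: j => //= j IH tauE; rewrite IH ?tauE// => m mj.
by rewrite tauE// leqW.
Qed.

(** Tasks after [l] see the earlier ones only through the start time of task [l.+1]. *)
Lemma eq_departure_after p tau tau' l j :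
  Num.max (departure p tau' l) (arrival p l.+1) =
    Num.max (departure p tau l) (arrival p l.+1) ->
  (forall m, (l < m)%N -> tau' m = tau m) ->
  (l < j)%N -> departure p tau' j = departure p tau j.
Proof.
move=> lE tauE; elim: j => //= j IH; rewrite ltnS leq_eqVlt => /predU1P[<-|lj].
  by rewrite lE tauE.
by rewrite IH// tauE// leqW.
Qed.

(** Shifting the departure of task [m] by [eps], of either sign, without creating idle time leaves
    every other departure unchanged, so the new schedule is feasible and its cost differs only in
    tasks [m] and [m.+1]. *)
Lemma optimal_exchange p tau m eps : wf_schedule p -> optimal p tau ->
  (1 <= m)%N -> (m.+1 <= ntasks p)%N ->
  arrival p m.+1 <= departure p tau m ->
  arrival p m.+1 <= departure p tau m + eps <= deadline p m ->
  0 < tau m + eps / nbits p m -> 0 < tau m.+1 - eps / nbits p m.+1 ->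
  nbits p m * energy p m (tau m) + nbits p m.+1 * energy p m.+1 (tau m.+1) <=
  nbits p m * energy p m (tau m + eps / nbits p m) +
    nbits p m.+1 * energy p m.+1 (tau m.+1 - eps / nbits p m.+1).
Proof.
move=> hp [feas opt] m1 mN am /andP[ame emd] t1 t2.
have vm0 : 0 < nbits p m by rewrite wf_nbits_gt0 ?m1 1?ltnW.
have vm1 : 0 < nbits p m.+1 by rewrite wf_nbits_gt0.
pose tau' : nat -> R :=
  [eta tau with m |-> tau m + eps / nbits p m, m.+1 |-> tau m.+1 - eps / nbits p m.+1].
have tau'm : tau' m = tau m + eps / nbits p m by rewrite /tau' /= eqxx.
have tau'm1 : tau' m.+1 = tau m.+1 - eps / nbits p m.+1.
  by rewrite /tau' /= eqxx -{1}(addn1 m) -{2}(addn0 m) eqn_add2l.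
have tau'E j : j != m -> j != m.+1 -> tau' j = tau j.
  by rewrite /tau' /= => /negbTE -> /negbTE ->.
have depm : departure p tau' m = departure p tau m + eps.
  case: (m) m1 tau'm tau'E vm0 => // l _ tau'm tau'E vm0 /=.
  rewrite tau'm (@eq_departure p tau) => [|j jl].
    by rewrite mulrDr mulrCA divff ?gt_eqF// mulr1 addrA.
  by rewrite tau'E// neq_ltn ltnS ?jl// leqW.
have depm1 : departure p tau' m.+1 = departure p tau m.+1.
  rewrite /= depm tau'm1 (max_idPl ame) (max_idPl am) mulrBr mulrCA divff ?gt_eqF//.
  by rewrite mulr1 addrACA subrr addr0.
have feas' : feasible p tau'.
  move=> j jN; split.
    have [->|jm] := eqVneq j m; first by rewrite tau'm.
    have [->|jm1] := eqVneq j m.+1; first by rewrite tau'm1.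
    by rewrite tau'E//; case: (feas j jN).
  have [jm|jm|->] := ltngtP j m.
  - rewrite (@eq_departure p tau) => [|l lj]; first by case: (feas j jN).
    by have lm := leq_ltn_trans lj jm; rewrite tau'E// neq_ltn ?lm// leqW.
  - have [jm1|jm1|->] := ltngtP j m.+1; first by move: (leq_trans jm1 jm); rewrite ltnn.
      rewrite (@eq_departure_after p tau tau' m.+1 j)//; first by case: (feas j jN).
        by rewrite depm1.
      by move=> l ml; rewrite tau'E// neq_ltn ?ml ?orbT// (ltnW ml) orbT.
    by rewrite depm1; case: (feas m.+1) => //; rewrite mN.
  - by rewrite depm.
have := opt _ feas'; rewrite /cost.
rewrite !(@big_cat_nat _ _ _ m 1 (ntasks p).+1)//=; try by rewrite leqW// ltnW.
rewrite !(@big_ltn _ _ _ m) ?ltnS 1?ltnW// !(@big_ltn _ _ _ m.+1) ?ltnS//.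
rewrite tau'm tau'm1.
rewrite (@eq_big_nat _ _ _ 1 m (fun i => nbits p i * energy p i (tau' i))
  (fun i => nbits p i * energy p i (tau i))); last first.
  by move=> j /andP[_ jm]; rewrite tau'E// neq_ltn ?ltnS ?jm// ltnW.
rewrite (@eq_big_nat _ _ _ m.+2 _ (fun i => nbits p i * energy p i (tau' i))
  (fun i => nbits p i * energy p i (tau i))); last first.
  by move=> j /andP[jm _]; rewrite tau'E// neq_ltn ?(ltnW jm) ?jm orbT.
lra.
Qed.

(** Slack before the deadline would let task [m] take time from task [m.+1], at a gain by
    [exchange_gain]. The bound [M] is the smaller of that slack and the whole transmission time of
    task [m.+1]. *)
Lemma optimal_deadline_tight p tau m : wf_schedule p -> optimal p tau ->
  (1 <= m)%N -> (m.+1 <= ntasks p)%N -> arrival p m.+1 <= departure p tau m ->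
  energy_slope p m (tau m) < energy_slope p m.+1 (tau m.+1) ->
  departure p tau m = deadline p m.
Proof.
move=> hp ho m1 mN am slt; have [feas _] := ho.
have hm : (1 <= m <= ntasks p)%N by rewrite m1 ltnW.
have hm1 : (1 <= m.+1 <= ntasks p)%N by rewrite mN.
have [t0 xd] := feas m hm; have [t10 _] := feas m.+1 hm1.
have v0 := wf_nbits_gt0 hp hm; have v1 := wf_nbits_gt0 hp hm1.
apply/eqP; rewrite eq_le xd /= leNgt; apply/negP => xd'.
pose M := Num.min (deadline p m - departure p tau m) (tau m.+1 * nbits p m.+1).
have M0 : 0 < M by rewrite lt_min subr_gt0 xd' mulr_gt0.
have [M1 M2] : M <= deadline p m - departure p tau m /\ M <= tau m.+1 * nbits p m.+1.
  by rewrite /M !ge_min !lexx !orbT.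
have [eps /andP[e0 eM]] := exchange_gain (energy_derivable (wf_energy hp hm) t0)
  (energy_derivable (wf_energy hp hm1) t10) slt v0 v1 M0.
apply/negP; rewrite -leNgt; apply: optimal_exchange => //.
- by apply/andP; split; lra.
- by rewrite addr_gt0// divr_gt0.
- by rewrite subr_gt0 ltr_pdivrMr//; lra.
Qed.

Lemma optimal_arrival_tight p tau m : wf_schedule p -> optimal p tau ->
  (1 <= m)%N -> (m.+1 <= ntasks p)%N -> arrival p m.+1 <= departure p tau m ->
  energy_slope p m.+1 (tau m.+1) < energy_slope p m (tau m) ->
  departure p tau m = arrival p m.+1.
Proof.
move=> hp ho m1 mN am slt; have [feas _] := ho.
have hm : (1 <= m <= ntasks p)%N by rewrite m1 ltnW.
have hm1 : (1 <= m.+1 <= ntasks p)%N by rewrite mN.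
have [t0 xd] := feas m hm; have [t10 _] := feas m.+1 hm1.
have v0 := wf_nbits_gt0 hp hm; have v1 := wf_nbits_gt0 hp hm1.
apply/eqP; rewrite eq_le am andbT leNgt; apply/negP => xa.
pose M := Num.min (departure p tau m - arrival p m.+1) (tau m * nbits p m).
have M0 : 0 < M by rewrite lt_min subr_gt0 xa mulr_gt0.
have [M1 M2] : M <= departure p tau m - arrival p m.+1 /\ M <= tau m * nbits p m.
  by rewrite /M !ge_min !lexx !orbT.
have [eps /andP[e0 eM]] := exchange_gain (energy_derivable (wf_energy hp hm1) t10)
  (energy_derivable (wf_energy hp hm) t0) slt v1 v0 M0.
(* Here task [m.+1] receives the time, so the departure of task [m] moves earlier. *)
have := @optimal_exchange p tau m (- eps) hp ho m1 mN am.
rewrite !mulNr opprK => le_exch.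
apply/negP; rewrite -leNgt addrC [leRHS]addrC; apply: le_exch.
- by apply/andP; split; lra.
- by rewrite subr_gt0 ltr_pdivrMr//; lra.
- by rewrite addr_gt0// divr_gt0.
Qed.

(** Energy strictly decreases with time, so remaining slack at the end of a busy period would be
    used up. *)
Lemma busy_period_last_departure p tau k n : wf_schedule p -> optimal p tau ->
  busy_period p tau k n -> departure p tau n = deadline p n.
Proof.
move=> hp [feas opt] [[/andP[k1 kn] nN] _ xa _].
have n1 := leq_trans k1 kn.
have hn : (1 <= n <= ntasks p)%N by rewrite n1.
have [t0 xd] := feas n hn; have v0 := wf_nbits_gt0 hp hn.
apply/eqP; rewrite eq_le xd /= leNgt; apply/negP => xd'.
(* Task n can be prolonged by eps without delaying task n + 1. *)
pose eps := Num.min (deadline p n - departure p tau n) (arrival p n.+1 - departure p tau n).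
have e0 : 0 < eps by rewrite lt_min !subr_gt0 xd' xa.
have [e1 e2] : eps <= deadline p n - departure p tau n /\
               eps <= arrival p n.+1 - departure p tau n.
  by rewrite /eps !ge_min !lexx !orbT.
pose tau' : nat -> R := [eta tau with n |-> tau n + eps / nbits p n].
have tau'n : tau' n = tau n + eps / nbits p n by rewrite /tau' /= eqxx.
have tau'E j : j != n -> tau' j = tau j by rewrite /tau' /= => /negbTE ->.
have depn : departure p tau' n = departure p tau n + eps.
  case: (n) n1 tau'n tau'E v0 => // l _ tau'n tau'E v0 /=.
  rewrite tau'n (@eq_departure p tau) => [|j jl].
    by rewrite mulrDr mulrCA divff ?gt_eqF// mulr1 addrA.
  by rewrite tau'E// neq_ltn ltnS jl.
have en0 : 0 < eps / nbits p n by rewrite divr_gt0.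
have feas' : feasible p tau'.
  move=> j jN; split.
    have [->|jm] := eqVneq j n; first by rewrite tau'n addr_gt0.
    by rewrite tau'E//; case: (feas j jN).
  have [jm|jm|->] := ltngtP j n.
  - rewrite (@eq_departure p tau) => [|l lj]; first by case: (feas j jN).
    by rewrite tau'E// neq_ltn (leq_ltn_trans lj jm).
  - rewrite (@eq_departure_after p tau tau' n j)//; first by case: (feas j jN).
      by rewrite depn !max_r//; lra.
    by move=> l ml; rewrite tau'E// neq_ltn ml orbT.
  - by rewrite depn; lra.
have := opt _ feas'; rewrite /cost; apply/negP; rewrite -ltNge.
rewrite !(@big_cat_nat _ _ _ n 1 (ntasks p).+1)//=; try by rewrite leqW// ltnW.
rewrite !(@big_ltn _ _ _ n) ?ltnS// tau'n.
rewrite (@eq_big_nat _ _ _ 1 n (fun i => nbits p i * energy p i (tau' i))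
  (fun i => nbits p i * energy p i (tau i))); last first.
  by move=> j /andP[_ jm]; rewrite tau'E// neq_ltn jm.
rewrite (@eq_big_nat _ _ _ n.+1 _ (fun i => nbits p i * energy p i (tau' i))
  (fun i => nbits p i * energy p i (tau i))); last first.
  by move=> j /andP[jm _]; rewrite tau'E// neq_ltn jm orbT.
rewrite ltrD2l ltrD2r ltr_pM2l//.
have t1 : 0 < tau n + eps / nbits p n by rewrite addr_gt0.
(* The tangent is taken at the longer time; its negative slope makes the shorter time strictly more
   expensive. *)
have := energy_tangent_lt (wf_energy hp hn) t1 t0 ltac:(by rewrite gt_eqF// ltrDl).
have := energy_derive1_lt0 (wf_energy hp hn) t1.
by rewrite opprD addrA subrr add0r; nra.
Qed.

Lemma busy_period_departure p tau k n j : wf_schedule p -> busy_period p tau k n ->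
  (k <= j <= n)%N ->
  departure p tau j = arrival p k + \sum_(k <= m < j.+1) tau m * nbits p m.
Proof.
move=> hp [[/andP[k1 kn] nN] xk _ xa] /andP[+ +].
elim: j => [|j IH]; first by rewrite leqn0 => /eqP k0; move: k1; rewrite k0.
rewrite leq_eqVlt => /predU1P[kE _|kj jn].
  rewrite -kE big_nat1 mulrC kE /= max_r//.
  (* For [k = 1] the condition on the previous task is vacuous; there the departure before task 1 is
     0 and [wf_arrival_ge0] applies. *)
  case: (j) xk kE => [_ _|l + kE]; last by rewrite kE /= => /(_ isT)/ltW.
  exact: wf_arrival_ge0.
rewrite ltnS in kj.
rewrite big_nat_recr 1?leqW//= max_l; last by rewrite xa// kj.
by rewrite (IH kj (ltnW jn)) mulrC addrA.
Qed.

End Exchange.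

(** * A discrete sign-change principle *)

(* Meant for e = x - y at the departures and g = slope on x - s in part (i), and
   for the opposites of both in part (ii). *)
Section SignChange.
Context {R : realDomainType}.
Variables (e g : nat -> R) (k r i : nat).
Hypotheses (kr : (k <= r)%N) (ri : (r < i)%N) (ek : e k = 0).
Hypothesis e_incr : forall j, (k <= j <= i)%N -> (e j < e j.+1) = (0 < g j).
Hypothesis e_decr : forall j, (k <= j <= i)%N -> (e j.+1 < e j) = (g j < 0).
Hypothesis g_up : forall j, (k <= j < i)%N -> g j < g j.+1 -> 0 <= e j.+1.
Hypothesis g_up_after : forall j, (r < j < i)%N -> g j < g j.+1 -> 0 < e j.+1.
Hypothesis g_down : forall j, (k <= j < i)%N -> g j.+1 < g j -> e j.+1 <= 0.
Hypotheses (er : e r.+1 <= 0) (ei : 0 < e i.+1).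

(** While [e] is positive, [g_down] forbids [g] to fall; hence a positive [g] would persist and push
    [e] above 0 at [r.+1], against [er]. *)
Let not_pos c : (k <= c <= r)%N -> 0 <= e c -> ~~ (0 < g c).
Proof.
move=> /andP[kc cr] ec; apply/negP => gc.
suff /(_ (r - c)%N) : forall t, (c + t <= r)%N -> 0 < g (c + t)%N /\ 0 < e (c + t).+1.
  by rewrite subnKC// leqnn [0 < e _]ltNge er => -[].
have hj j : (c <= j)%N -> (j <= r)%N -> (k <= j <= i)%N.
  by move=> cj jr; rewrite (leq_trans kc cj) (leq_trans jr (ltnW ri)).
elim=> [_|t IH].
  by rewrite addn0 gc; split=> //; apply: (le_lt_trans ec); rewrite e_incr ?hj.
rewrite addnS => tr; have [g0 e0] := IH (ltnW tr).
have ht : (k <= c + t < i)%N by rewrite (leq_trans kc (leq_addr _ _)) (ltn_trans tr ri).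
have g1 : 0 < g (c + t).+1.
  rewrite (lt_le_trans g0)// leNgt; apply/negP => /(g_down ht).
  by rewrite leNgt e0.
split=> //; apply: (lt_trans e0).
by rewrite e_incr// hj// leqW// leq_addr.
Qed.

(** While [e] is negative, [g_up] forbids [g] to rise; hence a negative [g] would persist up to [i],
    against [ei]. *)
Let not_neg c : (k <= c <= i)%N -> e c <= 0 -> ~~ (g c < 0).
Proof.
move=> /andP[kc ci] ec; apply/negP => gc.
suff /(_ (i - c)%N) : forall t, (c + t <= i)%N -> g (c + t)%N < 0 /\ e (c + t).+1 < 0.
  by rewrite subnKC// leqnn [e _ < 0]ltNge (ltW ei) => -[].
have hj j : (c <= j)%N -> (j <= i)%N -> (k <= j <= i)%N.
  by move=> cj ->; rewrite (leq_trans kc cj).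
elim=> [_|t IH].
  by rewrite addn0 gc; split=> //; apply: (lt_le_trans _ ec); rewrite e_decr ?hj.
rewrite addnS => ti; have [g0 e0] := IH (ltnW ti).
have ht : (k <= c + t < i)%N by rewrite (leq_trans kc (leq_addr _ _)) ti.
have g1 : g (c + t).+1 < 0.
  rewrite (le_lt_trans _ g0)// leNgt; apply/negP => /(g_up ht).
  by rewrite leNgt e0.
split=> //; apply: (lt_trans _ e0).
by rewrite e_decr// hj// leqW// leq_addr.
Qed.

(** From [e k = 0], the two previous facts keep [g] and then [e] at 0 through [r]. If [g] were not
    positive at [r.+1], then [e] would stay nonpositive up to [i.+1]: beyond [r] a rise of [g] needs
    [e] strictly positive, by [g_up_after]. *)
Lemma first_sign_change :
  (forall j, (k <= j <= r)%N -> g j = 0) /\ 0 < g r.+1.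
Proof.
have g0 j : (k <= j <= r)%N -> e j = 0 -> g j = 0 /\ e j.+1 = 0.
  move=> kjr ej.
  have kji : (k <= j <= i)%N by case/andP: kjr => -> jr; rewrite (leq_trans jr (ltnW ri)).
  have gp : ~~ (0 < g j) by rewrite not_pos// ej.
  have gn : ~~ (g j < 0) by rewrite not_neg// ej.
  split; apply/eqP; rewrite eq_le !leNgt.
    by rewrite gp gn.
  by rewrite -ej e_incr// e_decr// gp gn.
have e0 t : (k + t <= r.+1)%N -> e (k + t)%N = 0.
  elim: t => [|t IH]; rewrite ?addn0// addnS ltnS => tr.
  by have [] := g0 (k + t)%N _ (IH (leqW tr)); rewrite ?leq_addr.
split=> [j /andP[kj jr]|].
  have ej : e j = 0 by have := e0 (j - k)%N; rewrite subnKC// leqW// => ->.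
  by case: (g0 j _ ej); rewrite ?kj.
rewrite ltNge; apply/negP => gr.
suff /(_ (i - r.+1)%N) : forall t, (r.+1 + t <= i)%N ->
    g (r.+1 + t)%N <= 0 /\ e (r.+1 + t).+1 <= 0.
  by rewrite subnKC// leqnn [e _ <= 0]leNgt ei => -[].
have hj j : (r < j)%N -> (j <= i)%N -> (k <= j <= i)%N.
  by move=> rj ->; rewrite (leq_trans kr (ltnW rj)).
elim=> [_|t IH].
  rewrite addn0 gr; split=> //; apply: (le_trans _ er).
  by rewrite leNgt e_incr ?hj// -leNgt.
rewrite addnS => ti; have [g1 e1] := IH (ltnW ti).
have ht : (r < r.+1 + t < i)%N by rewrite ti leq_addr.
have g2 : g (r.+1 + t).+1 <= 0.
  rewrite (le_trans _ g1)// leNgt; apply/negP => /(g_up_after ht).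
  by rewrite ltNge e1.
split=> //; apply: (le_trans _ e1).
by rewrite leNgt e_incr -?leNgt// hj// leqW// leq_addr.
Qed.

End SignChange.

(** Abstracting the order [r] covers [R_index] and [L_index] at once. The last clause holds because,
    by transitivity, an index at least as good as [c] is itself extremal and so cannot exceed the
    maximum. *)
Lemma bigmax_last_extremal (r : rel nat) (k i : nat) (c := (\max_(k <= s < i |
    [forall j : 'I_i, (k <= j)%N ==> r s j]) s)%N) :
  total r -> transitive r -> (k < i)%N ->
  [/\ (k <= c < i)%N, forall j, (k <= j < i)%N -> r c j &
      forall j, (c < j < i)%N -> ~~ r j c].
Proof.
move=> rtot rtr ki; pose P s := [forall j : 'I_i, (k <= j)%N ==> r s j].
have PP s : reflect (forall j, (k <= j < i)%N -> r s j) (P s).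
  apply: (iffP forallP) => [H j /andP[kj ji]|H j].
    by have := H (Ordinal ji); rewrite /= kj.
  by apply/implyP => kj; apply: H; rewrite kj ltn_ord.
have [s0 ks0 Ps0] : exists2 s, (k <= s < i)%N & P s.
  suff [s ks H] : exists2 s, (k <= s < i)%N & forall j, (k <= j < i)%N -> r s j.
    by exists s => //; apply/PP.
  elim: i ki {c P PP} => // i IH; rewrite ltnS leq_eqVlt => /predU1P[->|/IH[s /andP[ks si] Hs]].
    exists i; rewrite ?leqnn//= => j; rewrite ltnS -eqn_leq => /eqP ->.
    by case/orP: (rtot j j).
  have H := rtot s i; case: (boolP (r s i)) H => /= [rsi _|_ ris].
    exists s => [|j /andP[kj]]; first by rewrite ks leqW.
    by rewrite ltnS leq_eqVlt => /predU1P[->//|ji]; rewrite Hs// kj.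
  exists i => [|j /andP[kj]]; first by rewrite (leq_trans ks (ltnW si)) /=.
  rewrite ltnS leq_eqVlt => /predU1P[->//|ji]; last by apply: rtr ris _; rewrite Hs// kj.
  by case/orP: (rtot i i).
have cmax s : (k <= s < i)%N -> P s -> (s <= c)%N.
  by move=> ks Ps; apply: (leq_bigmax_seq (F := id)) Ps; rewrite mem_index_iota.
have [kc Pc] : (k <= c < i)%N /\ P c.
  (* An empty maximum is 0, so 0 has to be told apart from an eligible index; in that case the
     eligible [s0] is itself 0. *)
  have : c = 0%N \/ ((k <= c < i)%N /\ P c).
    rewrite /c big_nat_cond; elim/big_rec: _ => [|s x]; first by left.
    move=> /andP[ks Ps] [->|[kx Px]]; first by right; rewrite maxn0.
    by right; case: (leqP s x).
  case=> // c0; have := cmax _ ks0 Ps0; rewrite c0 leqn0 => /eqP s00.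
  by rewrite -s00.
split=> //; first exact/PP.
move=> j /andP[cj ji]; apply/negP => rjc.
have : (j <= c)%N.
  apply: cmax; first by rewrite ji andbT; case/andP: kc => kc _; apply: leq_trans (ltnW cj).
  by apply/PP => l kl; apply: rtr rjc _; apply/PP: kl.
by rewrite leqNgt cj.
Qed.

(** * The first critical task of a busy period *)

Section BusyPeriod.
Context {R : realType}.
Variables (p : schedule R) (tau : nat -> R) (k n : nat).
Hypotheses (hp : wf_schedule p) (ho : optimal p tau) (hbp : busy_period p tau k n).
Implicit Types (i j l m c : nat) (s : R).

Let task m : (k <= m <= n)%N -> (1 <= m <= ntasks p)%N.
Proof.
by case: hbp => -[/andP[k1 _] nN] _ _ _ /andP[km mn]; rewrite (leq_trans k1)//= (leq_trans mn).
Qed.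

Let tau_gt0 m : (k <= m <= n)%N -> 0 < tau m.
Proof. by move=> /task /(ho.1 m)[]. Qed.

Let busy_ge_arrival j : (k <= j < n)%N -> arrival p j.+1 <= departure p tau j.
Proof. by case: hbp => _ _ _; apply. Qed.

Let le_deadline j : (k <= j <= n)%N -> departure p tau j <= deadline p j.
Proof. by move=> /task /(ho.1 j)[]. Qed.

(** Makes [sigma] at a deadline finite through [sigma_EFin]. *)
Lemma busy_period_arrival_lt_deadline j : (k <= j <= n)%N -> arrival p k < deadline p j.
Proof.
move=> kjn; apply: lt_le_trans (le_deadline kjn).
rewrite (busy_period_departure hp hbp kjn) ltrDl; apply: sumr_nat_gt0.
  by case/andP: kjn => kj _; rewrite ltnS.
move=> m /andP[km mj]; have kmn : (k <= m <= n)%N.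
  by rewrite km; case/andP: kjn => _; apply: leq_trans.
by rewrite mulr_gt0 ?tau_gt0// wf_nbits_gt0// task.
Qed.

Let in_range j : (k <= j <= n)%N -> (1 <= k <= j)%N /\ (j <= ntasks p)%N.
Proof.
by move=> kjn; have /andP[_ ->] := task kjn; case/andP: kjn => -> _; case: hbp => -[/andP[->]].
Qed.

(** The absence of conflict is used at the larger of [j] and [l], where [L_index] or [R_index] is
    extremal over a range containing the smaller one. If they coincide, the optimal departure lies
    between the arrival and the deadline. *)
Lemma no_conflict_before_le i : (k < i <= n)%N -> no_conflict_before p k i ->
  forall j l, (k <= j < i)%N -> (k <= l < i)%N ->
  (sigma p k j (arrival p k) (arrival p j.+1) <= sigma p k l (arrival p k) (deadline p l))%E.
Proof.
move=> /andP[ki ni] nc j l /andP[kj ji] /andP[kl li].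
have kjn : (k <= j < n)%N by rewrite kj (leq_trans ji).
case: (ltngtP j l) => [jl|lj|<-].
- have kl' := leq_ltn_trans kj jl.
  have [+ _] := nc l ltac:(by rewrite kl'); apply: le_trans.
  have [_ Lmax _] := bigmax_last_extremal
    (r := fun l j => (sigma p k j (arrival p k) (arrival p j.+1) <=
                      sigma p k l (arrival p k) (arrival p l.+1))%E)
    (fun x y => le_total _ _) (fun x y z xy yz => le_trans yz xy) kl'.
  by apply: Lmax; rewrite kj.
- have kj' := leq_ltn_trans kl lj.
  have [_ /le_trans] := nc j ltac:(by rewrite kj'); apply.
  have [_ Rmin _] := bigmax_last_extremal
    (r := fun l j => (sigma p k l (arrival p k) (deadline p l) <=
                      sigma p k j (arrival p k) (deadline p j))%E)
    (fun x y => le_total _ _) (fun x y z xy yz => le_trans xy yz) kj'.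
  by apply: Rmin; rewrite kl.
- have kjn' : (k <= j <= n)%N by case/andP: kjn => -> /ltnW.
  have [rk rN] := in_range kjn'.
  have [s [s0 -> sE]] := sigma_EFin hp rk rN (busy_period_arrival_lt_deadline kjn').
  by rewrite sigma_le// sE lerD2r (le_trans (busy_ge_arrival kjn))// le_deadline.
Qed.

Lemma first_critical_of_slopes c s : (k <= c < n)%N ->
  (forall j, (k <= j <= c)%N -> energy_slope p j (tau j) = s) ->
  s <> energy_slope p c.+1 (tau c.+1) -> first_critical p tau k n c.
Proof.
move=> /andP[kc cn] slopeE sc; split; first by rewrite kc ltnW.
  split; last by rewrite slopeE// kc leqnn.
  by exists k, n; split => //; rewrite ?kc ?(ltnW cn)//= ?leqW.
move=> j /andP[kj jn] [_ crit]; rewrite leqNgt; apply/negP => jc; apply: crit.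
by rewrite !slopeE ?kj ?(ltnW jc)//= leqW.
Qed.

(** How far the optimal path lags behind the path of common slope [s] from [arrival p k]. The index
    is shifted: [gap s j.+1] is the lag at the departure of task [j], and [gap s k] is 0. *)
Let gap s j : R := \sum_(k <= m < j) (tau m - slope_inv p m s) * nbits p m.

Let gapS s j : (k <= j)%N ->
  gap s j.+1 = gap s j + (tau j - slope_inv p j s) * nbits p j.
Proof. by move=> kj; rewrite /gap big_nat_recr. Qed.

Let gapE s j : (k <= j <= n)%N ->
  gap s j.+1 = departure p tau j - arrival p k - common_duration p k j s.
Proof.
move=> kjn; rewrite (busy_period_departure hp hbp kjn) [arrival p k + _]addrC addrK.
by rewrite /gap /common_duration -sumrB; apply: eq_bigr => m _; rewrite mulrBl.
Qed.

Let gap_incr s j : s < 0 -> (k <= j <= n)%N ->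
  (gap s j < gap s j.+1) = (0 < energy_slope p j (tau j) - s).
Proof.
move=> s0 kjn; rewrite gapS; last by case/andP: kjn.
rewrite ltrDl pmulr_lgt0 ?wf_nbits_gt0 ?task// !subr_gt0.
by rewrite slope_inv_ltr ?tau_gt0 ?task.
Qed.

Let gap_decr s j : s < 0 -> (k <= j <= n)%N ->
  (gap s j.+1 < gap s j) = (energy_slope p j (tau j) - s < 0).
Proof.
move=> s0 kjn; rewrite gapS; last by case/andP: kjn.
rewrite gtrDl pmulr_llt0 ?wf_nbits_gt0 ?task// !subr_lt0.
by rewrite slope_inv_gtr ?tau_gt0 ?task.
Qed.

Let deadline_tight j : (k <= j < n)%N ->
  energy_slope p j (tau j) < energy_slope p j.+1 (tau j.+1) ->
  departure p tau j = deadline p j.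
Proof.
move=> kjn; have /andP[kj jn] := kjn.
have /andP[j1 _] := task (ltac:(by rewrite kj ltnW) : (k <= j <= n)%N).
have /andP[_ j2] := task (ltac:(by rewrite leqW) : (k <= j.+1 <= n)%N).
by apply: optimal_deadline_tight => //; exact: busy_ge_arrival.
Qed.

Let arrival_tight j : (k <= j < n)%N ->
  energy_slope p j.+1 (tau j.+1) < energy_slope p j (tau j) ->
  departure p tau j = arrival p j.+1.
Proof.
move=> kjn; have /andP[kj jn] := kjn.
have /andP[j1 _] := task (ltac:(by rewrite kj ltnW) : (k <= j <= n)%N).
have /andP[_ j2] := task (ltac:(by rewrite leqW) : (k <= j.+1 <= n)%N).
by apply: optimal_arrival_tight => //; exact: busy_ge_arrival.
Qed.

Lemma right_critical_R_index i : (k < i <= n)%N -> no_conflict_before p k i ->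
  (sigma p k (R_index p k i) (arrival p k) (deadline p (R_index p k i))
     < sigma p k i (arrival p k) (arrival p i.+1))%E ->
  (i = n ->
   (sigma p k (R_index p k i) (arrival p k) (deadline p (R_index p k i))
      < sigma p k i (arrival p k) (deadline p i))%E) ->
  first_critical p tau k n (R_index p k i) /\
  right_critical p tau (R_index p k i).
Proof.
move=> kin nc; have /andP[ki ni] := kin.
have [krci Rmin Rlast] : [/\ (k <= R_index p k i < i)%N, _ & _] := bigmax_last_extremal
  (r := fun l j => (sigma p k l (arrival p k) (deadline p l) <=
                    sigma p k j (arrival p k) (deadline p j))%E)
  (fun x y => le_total _ _) (fun x y z xy yz => le_trans xy yz) ki.
have sep j kji := @no_conflict_before_le i kin nc j (R_index p k i) kji krci.
rewrite -/(R_index p k i) in Rmin Rlast.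
move: (R_index p k i) => r in krci Rmin Rlast sep *.
have /andP[kr ri] := krci.
have inkn j : (k <= j < i)%N -> (k <= j < n)%N.
  by case/andP=> -> ji; rewrite (leq_trans ji).
have inkn' j : (k <= j < i)%N -> (k <= j <= n)%N by move=> /inkn/andP[-> /ltnW].
have [rk rN] := in_range (inkn' r krci).
have [s [s0 sr durE]] := sigma_EFin hp rk rN (busy_period_arrival_lt_deadline (inkn' r krci)).
rewrite sr in Rmin Rlast sep * => Ai Di.
pose g j := energy_slope p j (tau j) - s.
have lt_g j : (g j < g j.+1) = (energy_slope p j (tau j) < energy_slope p j.+1 (tau j.+1)).
  by rewrite /g ltrD2r.
have gt_g j : (g j.+1 < g j) = (energy_slope p j.+1 (tau j.+1) < energy_slope p j (tau j)).
  by rewrite /g ltrD2r.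
(* Rises of [g] occur at deadlines and are controlled by [Rmin], or strictly by [Rlast] after [r];
   falls occur at arrivals and are controlled by [sep]. *)
have [] := @first_sign_change R (gap s) g k r i kr ri.
- by rewrite /gap big_geq.
- by move=> j /andP[kj ji]; rewrite gap_incr// kj (leq_trans ji).
- by move=> j /andP[kj ji]; rewrite gap_decr// kj (leq_trans ji).
- move=> j kji; rewrite lt_g => /(deadline_tight (inkn j kji)) xE.
  rewrite (gapE _ (inkn' j kji)) xE subr_ge0; have [jk jN] := in_range (inkn' j kji).
  by have := Rmin j kji; rewrite sigma_ge.
- move=> j rji; have kji : (k <= j < i)%N.
    by case/andP: rji => rj ->; rewrite (leq_trans kr (ltnW rj)).
  rewrite lt_g => /(deadline_tight (inkn j kji)) xE.
  rewrite (gapE _ (inkn' j kji)) xE subr_gt0; have [jk jN] := in_range (inkn' j kji).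
  by have := Rlast j rji; rewrite sigma_le// -ltNge.
- move=> j kji; rewrite gt_g => /(arrival_tight (inkn j kji)) xE.
  rewrite (gapE _ (inkn' j kji)) xE subr_le0; have [jk jN] := in_range (inkn' j kji).
  by have := sep j kji; rewrite sigma_le.
- by rewrite (gapE _ (inkn' r krci)) durE subr_le0 lerD2r le_deadline// inkn'.
- have kin' : (k <= i <= n)%N by rewrite ni ltnW.
  rewrite (gapE _ kin') subr_gt0; have [ik iN] := in_range kin'.
  (* Inside the busy period task [i] departs no earlier than the next arrival; the last task departs
     at its deadline, so there the comparison is made with [Di]. *)
  have [iln|ngi|ien] := ltngtP i n; last 2 first.
  + by move: ni; rewrite leqNgt ngi.
  + move: (Di ien); rewrite ltNge sigma_le// -ltNge => /lt_le_trans; apply.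
    by rewrite lerD2r ien (busy_period_last_departure hp ho hbp).
  + move: Ai; rewrite ltNge sigma_le// -ltNge => /lt_le_trans; apply.
    by rewrite lerD2r busy_ge_arrival// iln ltnW.
move=> g0; rewrite /g subr_gt0 => gr.
have slopeE j : (k <= j <= r)%N -> energy_slope p j (tau j) = s.
  by move=> /g0/eqP; rewrite /g subr_eq0 => /eqP.
split.
  apply: (first_critical_of_slopes (inkn r krci) slopeE).
  by apply/eqP; rewrite lt_eqF.
split; last by rewrite (slopeE r)// kr leqnn.
exists k, n; split => //; first exact: inkn'.
by rewrite leqW//= (leq_trans ri).
Qed.

Lemma left_critical_L_index i : (k < i <= n)%N -> no_conflict_before p k i ->
  (sigma p k i (arrival p k) (deadline p i)
     < sigma p k (L_index p k i) (arrival p k) (arrival p (L_index p k i).+1))%E ->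
  first_critical p tau k n (L_index p k i) /\
  left_critical p tau (L_index p k i).
Proof.
move=> kin nc; have /andP[ki ni] := kin.
have [krci Lmax Llast] : [/\ (k <= L_index p k i < i)%N, _ & _] := bigmax_last_extremal
  (r := fun l j => (sigma p k j (arrival p k) (arrival p j.+1) <=
                    sigma p k l (arrival p k) (arrival p l.+1))%E)
  (fun x y => le_total _ _) (fun x y z xy yz => le_trans yz xy) ki.
have sep j kji := @no_conflict_before_le i kin nc (L_index p k i) j krci kji.
rewrite -/(L_index p k i) in Lmax Llast.
move: (L_index p k i) => r in krci Lmax Llast sep *.
have /andP[kr ri] := krci.
have inkn j : (k <= j < i)%N -> (k <= j < n)%N.
  by case/andP=> -> ji; rewrite (leq_trans ji).
have inkn' j : (k <= j < i)%N -> (k <= j <= n)%N by move=> /inkn/andP[-> /ltnW].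
have [rk rN] := in_range (inkn' r krci).
(* By [Di] the slope at [L_index] exceeds another one, so it is not -oo and the time interval is
   nondegenerate. *)
move=> Di; have akr : arrival p k < arrival p r.+1.
  rewrite ltNge; apply/negP => ra; move: Di.
  have -> : sigma p k r (arrival p k) (arrival p r.+1) = -oo%E by rewrite /sigma ltNge ra.
  by rewrite ltNge leNye.
have [s [s0 sr durE]] := sigma_EFin hp rk rN akr.
rewrite sr in Lmax Llast sep Di.
pose g j := s - energy_slope p j (tau j).
have lt_g j : (g j < g j.+1) = (energy_slope p j.+1 (tau j.+1) < energy_slope p j (tau j)).
  by rewrite /g ltrD2l ltrN2.
have gt_g j : (g j.+1 < g j) = (energy_slope p j (tau j) < energy_slope p j.+1 (tau j.+1)).
  by rewrite /g ltrD2l ltrN2.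
(* With both signs reversed, rises of [g] occur at arrivals and falls at deadlines. The final
   inequality only needs task [i] to meet its deadline, so [i = n] is no special case. *)
have [] := @first_sign_change R (fun j => - gap s j) g k r i kr ri.
- by rewrite /gap big_geq ?oppr0.
- move=> j /andP[kj ji]; rewrite ltrN2 gap_decr ?kj ?(leq_trans ji)//.
  by rewrite /g subr_lt0 subr_gt0.
- move=> j /andP[kj ji]; rewrite ltrN2 gap_incr ?kj ?(leq_trans ji)//.
  by rewrite /g subr_lt0 subr_gt0.
- move=> j kji; rewrite lt_g => /(arrival_tight (inkn j kji)) xE.
  rewrite (gapE _ (inkn' j kji)) xE oppr_ge0 subr_le0; have [jk jN] := in_range (inkn' j kji).
  by have := Lmax j kji; rewrite sigma_le.
- move=> j rji; have kji : (k <= j < i)%N.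
    by case/andP: rji => rj ->; rewrite (leq_trans kr (ltnW rj)).
  rewrite lt_g => /(arrival_tight (inkn j kji)) xE.
  rewrite (gapE _ (inkn' j kji)) xE oppr_gt0 subr_lt0; have [jk jN] := in_range (inkn' j kji).
  by have := Llast j rji; rewrite sigma_ge// -ltNge.
- move=> j kji; rewrite gt_g => /(deadline_tight (inkn j kji)) xE.
  rewrite (gapE _ (inkn' j kji)) xE oppr_le0 subr_ge0; have [jk jN] := in_range (inkn' j kji).
  by have := sep j kji; rewrite sigma_ge.
- by rewrite (gapE _ (inkn' r krci)) durE oppr_le0 subr_ge0 lerD2r busy_ge_arrival// inkn.
- have kin' : (k <= i <= n)%N by rewrite ni ltnW.
  rewrite (gapE _ kin') oppr_gt0 subr_lt0; have [ik iN] := in_range kin'.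
  move: Di; rewrite ltNge sigma_ge// -ltNge; apply: le_lt_trans.
  by rewrite lerD2r le_deadline.
move=> g0; rewrite /g subr_gt0 => gr.
have slopeE j : (k <= j <= r)%N -> energy_slope p j (tau j) = s.
  by move=> /g0/eqP; rewrite /g subr_eq0 => /eqP.
split.
  apply: (first_critical_of_slopes (inkn r krci) slopeE).
  by apply/eqP; rewrite gt_eqF.
split; last by rewrite (slopeE r)// kr leqnn.
exists k, n; split => //; first exact: inkn'.
by rewrite leqW//= (leq_trans ri).
Qed.

End BusyPeriod.

(* In the first part, sigma p k n a_k a_(n+1) with a_(n+1) > d_n overestimates
   the slope that tasks k, ..., n can share, since task n departs at d_n; for
   i = n the criterion is therefore also required at d_n, without which it is
   not sufficient. *)
Theorem mainTheorem7 (R : realType) (p : schedule R) (tau : nat -> R)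
    (k n : nat) (hp : wf_schedule p) (htau : optimal p tau)
    (hbp : busy_period p tau k n) :
  (forall i : nat, (k < i <= n)%N ->
     no_conflict_before p k i ->
     (sigma p k (R_index p k i) (arrival p k) (deadline p (R_index p k i))
        < sigma p k i (arrival p k) (arrival p i.+1))%E ->
     (i = n ->
      (sigma p k (R_index p k i) (arrival p k) (deadline p (R_index p k i))
         < sigma p k i (arrival p k) (deadline p i))%E) ->
     first_critical p tau k n (R_index p k i) /\
     right_critical p tau (R_index p k i))
  /\
  (forall i : nat, (k < i <= n)%N ->
     no_conflict_before p k i ->
     (sigma p k i (arrival p k) (deadline p i)
        < sigma p k (L_index p k i) (arrival p k) (arrival p (L_index p k i).+1))%E ->
     first_critical p tau k n (L_index p k i) /\
     left_critical p tau (L_index p k i)).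
Proof.
split=> i; first exact: right_critical_R_index.
exact: left_critical_L_index.
Qed.
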